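(* (i) Let $P$ be the transition kernel of a lazy irreducible discrete-time birth-and-death chain on $\{0,\ldots,n\}$ with stationary distribution $\pi$. Then for every integer $t>0$, the quantity $1-P^t(x,y)/\pi(y)$, over $x,y\in\{0,\ldots,n\}$, is maximized when $x,y$ are the endpoints; that is, $\max_{x,y}\big(1-P^t(x,y)/\pi(y)\big)=1-P^t(0,n)/\pi(n)=1-P^t(n,0)/\pi(0)$. (ii) Let $H_t$ be the heat kernel of an irreducible continuous-time birth-and-death chain on $\{0,\ldots,n\}$ with stationary distribution $\pi$. Then for every real $t>0$, the quantity $1-H_t(x,y)/\pi(y)$, over $x,y\in\{0,\ldots,n\}$, is maximized when $x,y$ are the endpoints; that is, $\max_{x,y}\big(1-H_t(x,y)/\pi(y)\big)=1-H_t(0,n)/\pi(n)=1-H_t(n,0)/\pi(0)$.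
   Context: A discrete-time birth-and-death chain on $\{0,\ldots,n\}$ is a Markov chain whose transition kernel $P$ satisfies $P(x,y)=0$ whenever $|x-y|>1$. It is lazy if $P(x,x)\ge\frac12$ for all $x$. A continuous-time birth-and-death chain has heat kernel $H_t=\mathrm e^{t(P-I)}$, $t\ge0$ real, where $P$ is a stochastic matrix on $\{0,\ldots,n\}$ with $P(x,y)=0$ whenever $|x-y|>1$ (no laziness of $P$ is assumed); it is irreducible if $P$ is. *)

(* Defs.v *)
From HB Require Import structures.
From mathcomp Require Import all_boot all_order all_algebra.
From mathcomp Require Import all_classical all_reals all_analysis.

Set Implicit Arguments.
Unset Strict Implicit.
Unset Printing Implicit Defensive.

Import Order.TTheory GRing.Theory Num.Theory.
Import numFieldNormedType.Exports.

Local Open Scope classical_set_scope.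
Local Open Scope ring_scope.

Section Chains.
Variables (R : realType) (n : nat).
Implicit Types (A P : 'M[R]_n.+1) (pi : 'rV[R]_n.+1) (t : R).

Definition stochastic P : Prop :=
  (forall x y, 0 <= P x y) /\ (forall x, \sum_y P x y = 1).

(* The states are the naturals 0, ..., n; the distance is taken in [int],
   where the subtraction is neither truncated nor modular. *)
Definition birth_and_death P : Prop :=
  stochastic P /\
  (forall x y : 'I_n.+1, (1 < `|Posz x - Posz y|)%N -> P x y = 0).

Definition lazy P : Prop := forall x, 2^-1 <= P x x.

Definition irreducible P : Prop :=
  forall x y, exists k : nat, 0 < (P ^+ k) x y.

Definition distribution pi : Prop :=
  (forall y, 0 <= pi ord0 y) /\ \sum_y pi ord0 y = 1.

Definition stationary P pi : Prop := distribution pi /\ pi *m P = pi.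

(* The limit is taken in the space of matrices over R (sup norm), where it exists for every A,
   so the total operator [limn] is the genuine sum of the series. *)
Definition expmx A : 'M[R]_n.+1 :=
  limn (series (fun k => k`!%:R^-1 *: A ^+ k)).

Definition heat_kernel P t : 'M[R]_n.+1 := expmx (t *: (P - 1)).

(* Stationarity for a continuous-time chain: invariance under the whole
   semigroup (H_t), t >= 0. *)
Definition stationary_semigroup (H : R -> 'M[R]_n.+1) pi : Prop :=
  distribution pi /\ (forall t, 0 <= t -> pi *m H t = pi).

(* The entry at (x, y) is the quantity whose maximum over x and y is the
   separation distance of K from pi. *)
Definition separation (K : 'M[R]_n.+1) pi (x y : 'I_n.+1) : R :=
  1 - K x y / pi ord0 y.

Definition is_max_value (f : 'I_n.+1 -> 'I_n.+1 -> R) (m : R) : Prop :=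
  (exists x y, f x y = m) /\ (forall x y, f x y <= m).

End Chains.

(* Main.v *)
Require Import Defs.
From HB Require Import structures.
From mathcomp Require Import all_boot all_order all_algebra.
From mathcomp Require Import all_classical all_reals all_analysis.
From mathcomp Require Import zify ring lra.

Import Order.TTheory GRing.Theory Num.Theory.
Import numFieldNormedType.Exports.

Local Open Scope ring_scope.

(* A lazy birth-and-death operator preserves nondecreasing, nonincreasing and
   unimodal functions, as one sees on the successive differences. Hence every
   column x |-> P^t x y is unimodal and is smallest at x = 0 or x = n. By
   reversibility P^t x y / pi y is symmetric in x and y, so a second step along
   the monotone column 0 or n bounds it below by its value at the corner (0, n).
   In continuous time, H_t is the limit of (1 + t / N (P - 1))^N, whose base is
   a lazy birth-and-death kernel, reversible for the same pi, once N >= 2 t. *)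

(** * Lazy birth-and-death operators *)

(* At k = 0 the last term vanishes because 0.-1 = 0. *)
Definition bd_op {R : pzRingType} (p q f : nat -> R) (k : nat) : R :=
  f k + p k * (f k.+1 - f k) + q k * (f k.-1 - f k).

Definition unimodal {R : numDomainType} (f : nat -> R) : Prop :=
  exists m : nat, (forall k, (k < m)%N -> f k <= f k.+1) /\
                  (forall k, (m <= k)%N -> f k.+1 <= f k).

Definition lazy_rates {R : numFieldType} (p q : nat -> R) : Prop :=
  forall k, [/\ 0 <= p k, 0 <= q k & p k + q k <= 2^-1].

(** Under [lazy_rates] the three coefficients are nonnegative, so a sign common to three consecutive
    differences of f passes to the new difference. At k = 0 the last difference is f 0 - f 0. *)
Lemma bd_op_diff (R : comPzRingType) (p q f : nat -> R) (k : nat) :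
  bd_op p q f k.+1 - bd_op p q f k =
  (1 - p k - q k.+1) * (f k.+1 - f k) + p k.+1 * (f k.+2 - f k.+1)
  + q k * (f k - f k.-1).
Proof. by rewrite /bd_op /=; ring. Qed.

Lemma bd_opN (R : comPzRingType) (p q f : nat -> R) (k : nat) :
  bd_op p q (fun i => - f i) k = - bd_op p q f k.
Proof. by rewrite /bd_op; ring. Qed.

Lemma bd_op_step (R : realFieldType) (p q f : nat -> R) (k : nat) :
  lazy_rates p q -> f k.-1 <= f k -> f k <= f k.+1 -> f k.+1 <= f k.+2 ->
  bd_op p q f k <= bd_op p q f k.+1.
Proof.
move=> pq f1 f2 f3; rewrite -subr_ge0 bd_op_diff.
have [p1 q1 pq1] := pq k; have [p2 q2 pq2] := pq k.+1.
rewrite !addr_ge0// mulr_ge0// ?subr_ge0//; lra.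
Qed.

Lemma bd_op_stepN (R : realFieldType) (p q f : nat -> R) (k : nat) :
  lazy_rates p q -> f k <= f k.-1 -> f k.+1 <= f k -> f k.+2 <= f k.+1 ->
  bd_op p q f k.+1 <= bd_op p q f k.
Proof.
move=> pq f1 f2 f3; rewrite -lerN2 -!bd_opN.
by apply: bd_op_step => //; rewrite lerN2.
Qed.

(* By laziness each of the two differences around the mode m is weighted at
   least as much as it is in the other one, so the new differences cannot be
   negative before m and positive after it. *)
Lemma bd_op_mode (R : realFieldType) (p q f : nat -> R) (m : nat) :
  lazy_rates p q ->
  (forall k, (k <= m)%N -> f k <= f k.+1) ->
  (forall k, (m < k)%N -> f k.+1 <= f k) ->
  bd_op p q f m <= bd_op p q f m.+1 \/ bd_op p q f m.+2 <= bd_op p q f m.+1.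
Proof.
move=> pq up dn.
have [p1 q1 pq1] := pq m; have [p2 q2 pq2] := pq m.+1; have [p3 q3 pq3] := pq m.+2.
have d1 : 0 <= f m.+1 - f m by rewrite subr_ge0 up.
have d2 : 0 <= f m.+1 - f m.+2 by rewrite subr_ge0 dn.
have d0 : 0 <= f m - f m.-1.
  by rewrite subr_ge0; case: m up {dn pq1 pq2 pq3 p1 q1 p2 q2 p3 q3 d1 d2} => //= m ->.
have d3 : 0 <= f m.+2 - f m.+3 by rewrite subr_ge0 dn.
have [le|lt] := leP (f m.+1 - f m.+2) (f m.+1 - f m); [left|right].
- rewrite -subr_ge0 bd_op_diff.
  have := mulr_ge0 q1 d0; have := mulr_ge0 p2 d2.
  have : 0 <= p m.+1 * ((f m.+1 - f m) - (f m.+1 - f m.+2)).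
    by rewrite mulr_ge0// subr_ge0.
  have : 0 <= (1 - p m - q m.+1 - p m.+1) * (f m.+1 - f m).
    by rewrite mulr_ge0//; lra.
  lra.
- rewrite -subr_le0 bd_op_diff /=.
  have := mulr_ge0 p3 d3; have := mulr_ge0 q2 d1.
  have : 0 <= q m.+1 * ((f m.+1 - f m.+2) - (f m.+1 - f m)).
    by rewrite mulr_ge0// subr_ge0 ltW.
  have : 0 <= (1 - p m.+1 - q m.+2 - q m.+1) * (f m.+1 - f m.+2).
    by rewrite mulr_ge0//; lra.
  lra.
Qed.

Lemma unimodal_bd_op (R : realFieldType) (p q f : nat -> R) :
  lazy_rates p q -> unimodal f -> unimodal (bd_op p q f).
Proof.
move=> pq [[|m] [up dn]].
  by exists 0%N; split=> // k _; apply: bd_op_stepN; rewrite ?dn//; case: k => //= k; rewrite dn.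
have up' k : (k < m)%N -> bd_op p q f k <= bd_op p q f k.+1.
  move=> km; apply: bd_op_step; rewrite ?up//; try by lia.
  by case: k km => //= k km; rewrite up//; lia.
have dn' k : (m.+1 < k)%N -> bd_op p q f k.+1 <= bd_op p q f k.
  by case: k => // k km; apply: bd_op_stepN; rewrite ?dn//=; lia.
(* Only the differences at m and m.+1 are still open. [bd_op_mode] excludes a strict decrease
   followed by a strict increase; the other sign patterns put the new mode at m.+2, m.+1 or m. *)
have [h|h] := bd_op_mode R p q f m pq up dn.
- have [h'|/ltW h'] := leP (bd_op p q f m.+1) (bd_op p q f m.+2).
  + exists m.+2; split => [k|k km]; last exact: dn'.
    rewrite ltnS leq_eqVlt => /predU1P[->//|]; rewrite ltnS leq_eqVlt.
    by move=> /predU1P[->//|]; apply: up'.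
  + exists m.+1; split => k; last by rewrite leq_eqVlt => /predU1P[<-//|]; apply: dn'.
    by rewrite ltnS leq_eqVlt => /predU1P[->//|]; apply: up'.
- have [h'|/ltW h'] := leP (bd_op p q f m) (bd_op p q f m.+1).
  + exists m.+1; split => k; last by rewrite leq_eqVlt => /predU1P[<-//|]; apply: dn'.
    by rewrite ltnS leq_eqVlt => /predU1P[->//|]; apply: up'.
  + exists m; split => // k; rewrite leq_eqVlt => /predU1P[<-//|].
    by rewrite leq_eqVlt => /predU1P[<-//|]; apply: dn'.
Qed.

Lemma unimodal_ge_ends (R : numDomainType) (f : nat -> R) (n k : nat) :
  unimodal f -> (k <= n)%N -> f 0%N <= f k \/ f n <= f k.
Proof.
move=> [m [up dn]] kn; have [km|mk] := leqP k m; [left|right].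
- elim: k km {kn} => // k IHk km; apply: le_trans (up _ km).
  by apply: IHk; apply: ltnW.
- rewrite -(subnKC kn); elim: (n - k)%N => [|d IHd]; first by rewrite addn0.
  by rewrite addnS (le_trans _ IHd)// dn//; lia.
Qed.

(* Functions on the states are extended to nat by their value at n, so that
   the boundary terms of bd_op vanish. *)
Definition extend {T : Type} {n : nat} (v : 'I_n.+1 -> T) (k : nat) : T :=
  v (inord (minn k n)).

(** Out of range, [inord] would return the state 0. Setting the rates to 0 there lets [lazy_rates]
    hold at every natural. *)
Definition up_rate {R : pzRingType} {n : nat} (P : 'M[R]_n.+1) (k : nat) : R :=
  if (k < n)%N then P (inord k) (inord k.+1) else 0.

Definition down_rate {R : pzRingType} {n : nat} (P : 'M[R]_n.+1) (k : nat) : R :=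
  if (0 < k <= n)%N then P (inord k) (inord k.-1) else 0.

Lemma extend_ord (T : Type) (n : nat) (v : 'I_n.+1 -> T) (x : 'I_n.+1) :
  extend v x = v x.
Proof. by rewrite /extend (minn_idPl _) ?inord_val// -ltnS. Qed.

Lemma sum_neighbours (V : nmodType) (n : nat) (G : 'I_n.+1 -> V) (x : 'I_n.+1) :
  G x = 0 -> (forall z : 'I_n.+1, (1 < `|Posz x - Posz z|)%N -> G z = 0) ->
  \sum_z G z = (if (x < n)%N then G (inord x.+1) else 0)
             + (if (0 < x)%N then G (inord x.-1) else 0).
Proof.
move=> Gx Gfar.
(* Conditions on the values in nat are simply empty at a missing neighbour; the form z.+1 == x
   avoids 0.-1 = 0. *)
have -> : \sum_z G z = \sum_(z : 'I_n.+1 | z == x.+1 :> nat) G z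
                     + \sum_(z : 'I_n.+1 | z.+1 == x :> nat) G z.
  rewrite [X in _ = X + _]big_mkcond [X in _ = _ + X]big_mkcond -big_split.
  apply: eq_bigr => z _ /=.
  have [e1|n1] := eqVneq (z : nat) x.+1.
    by rewrite ifF ?addr0//; lia.
  have [e2|n2] := eqVneq z.+1 (x : nat); first by rewrite add0r.
  have [<-|n3] := eqVneq x z; first by rewrite Gx addr0.
  by rewrite Gfar ?addr0//; move/eqP : n3 => n3; have : (x : nat) <> z by [move/val_inj]; lia.
have xn := ltn_ord x.
congr (_ + _).
- case: ifPn => xn'.
  + apply: big_pred1 => z /=; apply/eqP/eqP => [e|->]; last by rewrite inordK.
    by rewrite -e inord_val.
  + by rewrite big_pred0// => z; have := ltn_ord z; lia.
- case: ifPn => x0.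
  + apply: big_pred1 => z /=; apply/eqP/eqP => [<-|->]; first by rewrite inord_val.
    by rewrite inordK; lia.
  + by rewrite big_pred0// => z; lia.
Qed.

Lemma kernel_bd_op (R : realType) (n : nat) (P : 'M[R]_n.+1) (v : 'I_n.+1 -> R)
    (x : 'I_n.+1) :
  birth_and_death P ->
  \sum_z P x z * v z = bd_op (up_rate P) (down_rate P) (extend v) x.
Proof.
move=> [[_ P1] Pfar].
(* Unit row sums allow passing to the increments of v, which removes the diagonal entry. *)
have -> : \sum_z P x z * v z = v x + \sum_z P x z * (v z - v x).
  under [X in _ = _ + X]eq_bigr do rewrite mulrBr.
  by rewrite sumrB -mulr_suml P1 mul1r addrC subrK.
rewrite (@sum_neighbours _ _ _ x); first last.
- by move=> z xz; rewrite Pfar// mul0r.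
- by rewrite subrr mulr0.
rewrite /bd_op extend_ord -addrA; congr (_ + (_ + _)).
- rewrite /up_rate inord_val; case: ifPn => xn; last by rewrite mul0r.
  by rewrite -[X in extend v X](@inordK n x.+1)// extend_ord.
- rewrite /down_rate inord_val -(ltnS x n) ltn_ord andbT; case: ifPn => x0; last by rewrite mul0r.
  have xn := ltn_ord x.
  by rewrite -[X in extend v X](@inordK n x.-1) ?extend_ord//; lia.
Qed.

Lemma lazy_chain_rates (R : realType) (n : nat) (P : 'M[R]_n.+1) :
  birth_and_death P -> lazy P -> lazy_rates (up_rate P) (down_rate P).
Proof.
move=> [[P0 P1] Pfar] lP k.
have u0 : 0 <= up_rate P k by rewrite /up_rate; case: ifP.
have d0 : 0 <= down_rate P k by rewrite /down_rate; case: ifP.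
split=> //; have [kn|kn] := leqP k n; last first.
  by rewrite /up_rate /down_rate ltnNge ltnW//= (leqNgt k n) kn andbF addr0 invr_ge0.
pose x : 'I_n.+1 := inord k; have xk : x = k :> nat by rewrite inordK.
(* The row of P without its diagonal entry: its sum is both 1 - P x x and the sum of the two
   rates. *)
pose G z := if z == x then 0 else P x z.
have Gx : G x = 0 by rewrite /G eqxx.
have H := @sum_neighbours _ _ G x Gx.
have {H} : \sum_z G z = up_rate P k + down_rate P k.
  rewrite H; last by move=> z xz; rewrite /G; case: ifP => // _; apply: Pfar.
  rewrite /up_rate /down_rate /G xk kn andbT -/x; congr (_ + _).
  - by case: ifPn => // ?; rewrite ifF// -val_eqE /= xk inordK//; lia.
  - by case: ifPn => // ?; rewrite ifF// -val_eqE /= xk inordK//; lia.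
have : \sum_z P x z = P x x + \sum_z G z.
  rewrite (bigD1 x)//= [in RHS](bigD1 x)//= Gx add0r; congr (_ + _).
  by apply: eq_bigr => z /negbTE zx; rewrite /G zx.
by rewrite P1; have := lP x; lra.
Qed.

(** The truncation [minn k n] matters: past n the rates vanish and [bd_op] acts as the identity,
    whereas the extended image keeps its value at n. *)
Lemma extend_kernel (R : realType) (n : nat) (P : 'M[R]_n.+1) (v : 'I_n.+1 -> R)
    (k : nat) :
  birth_and_death P ->
  extend (fun x => \sum_z P x z * v z) k =
  bd_op (up_rate P) (down_rate P) (extend v) (minn k n).
Proof. by move=> bP; rewrite {1}/extend kernel_bd_op// inordK// ltnS geq_minr. Qed.

Lemma nondecreasing_truncate (R : numDomainType) (n : nat) (g : nat -> R) :
  (forall k, (k < n)%N -> g k <= g k.+1) ->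
  forall k, g (minn k n) <= g (minn k.+1 n).
Proof.
move=> gle k; have [kn|nk] := ltnP k n.
  by rewrite (minn_idPl kn) gle.
by rewrite (minn_idPr (leqW nk)).
Qed.

Lemma unimodal_truncate (R : numDomainType) (n : nat) (g : nat -> R) :
  unimodal g -> unimodal (fun k => g (minn k n)).
Proof.
move=> [m [up dn]]; exists m; split=> k km; have [kn|nk] := ltnP k n.
- by rewrite (minn_idPl kn) up.
- by rewrite (minn_idPr (leqW nk)).
- by rewrite (minn_idPl kn) dn.
- by rewrite (minn_idPr (leqW nk)).
Qed.

(** * Columns of the powers of a lazy kernel *)

Lemma expr_kernel_extend (R : realType) (n : nat) (P : 'M[R]_n.+1) (y : 'I_n.+1)
    (t k : nat) :
  birth_and_death P ->
  extend (fun x => (P ^+ t.+1) x y) k =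
  bd_op (up_rate P) (down_rate P) (extend (fun x => (P ^+ t) x y)) (minn k n).
Proof.
move=> bP; rewrite -extend_kernel// /extend.
by rewrite exprS -[_ * _]/(_ *m _) mxE.
Qed.

Lemma unimodal_column (R : realType) (n : nat) (P : 'M[R]_n.+1) (t : nat)
    (y : 'I_n.+1) :
  birth_and_death P -> lazy P -> unimodal (extend (fun x => (P ^+ t) x y)).
Proof.
move=> bP lP; elim: t => [|t [m [up dn]]].
  have e k : extend (fun x => (P ^+ 0) x y) k = (minn k n == y)%:R.
    rewrite /extend expr0 /= mxE; congr (_%:R).
    by rewrite -val_eqE /= inordK// ltnS geq_minr.
  have yn := ltn_ord y.
  exists y; split=> k ky; rewrite !e ler_nat.
  - by have -> : (minn k n == y) = false by lia.
  - by have [h|] := eqVneq (minn k.+1 n) y => //; have -> : (minn k n == y) by lia.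
have [m' [up' dn']] := unimodal_truncate _ n _
  (unimodal_bd_op _ _ _ _ (lazy_chain_rates _ _ _ bP lP) (ex_intro _ m (conj up dn))).
by exists m'; split=> k km; rewrite !expr_kernel_extend//; [apply: up'|apply: dn'].
Qed.

(** At time 0 the column is the indicator of n, equal to 1 beyond n, and each lazy step preserves
    monotonicity. *)
Lemma nondecreasing_last_column (R : realType) (n : nat) (P : 'M[R]_n.+1) (t k : nat) :
  birth_and_death P -> lazy P ->
  extend (fun x => (P ^+ t) x ord_max) k <= extend (fun x => (P ^+ t) x ord_max) k.+1.
Proof.
move=> bP lP; elim: t k => [|t IHt] k.
  rewrite /extend expr0 !mxE ler_nat -!val_eqE /= !inordK ?ltnS ?geq_minr//; lia.
rewrite !expr_kernel_extend//; apply: nondecreasing_truncate => j jn.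
apply: bd_op_step => //; first exact: lazy_chain_rates.
by case: j {jn} => //=.
Qed.

Lemma nonincreasing_first_column (R : realType) (n : nat) (P : 'M[R]_n.+1) (t k : nat) :
  birth_and_death P -> lazy P ->
  extend (fun x => (P ^+ t) x ord0) k.+1 <= extend (fun x => (P ^+ t) x ord0) k.
Proof.
move=> bP lP; elim: t k => [|t IHt] k.
  rewrite /extend expr0 !mxE ler_nat -!val_eqE /= !inordK ?ltnS ?geq_minr//; lia.
rewrite !expr_kernel_extend//.
rewrite -lerN2 -!bd_opN.
apply: (@nondecreasing_truncate _ _ (bd_op _ _ _)) => j jn.
apply: bd_op_step; rewrite ?lerN2//; first exact: lazy_chain_rates.
by case: j {jn} => //=.
Qed.

(** * Reversibility *)

Definition reversible {R : pzRingType} {n : nat} (P : 'M[R]_n.+1) (pi : 'rV[R]_n.+1) : Prop :=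
  forall x y, pi ord0 x * P x y = pi ord0 y * P y x.

Lemma reversible_expr (R : comPzRingType) (n : nat) (P : 'M[R]_n.+1)
    (pi : 'rV[R]_n.+1) (t : nat) :
  reversible P pi -> reversible (P ^+ t) pi.
Proof.
move=> rP; elim: t => [|t IHt] x y.
  by rewrite expr0 !mxE eq_sym; case: eqP => [->//|_]; rewrite !mulr0.
rewrite [in LHS]exprS exprSr -[_ * _ ^+ _]/(_ *m _) -[_ ^+ _ * P]/(_ *m _) !mxE !mulr_sumr.
by apply: eq_bigr => z _; rewrite mulrA rP mulrAC IHt -mulrA.
Qed.

(* The net flow F x y = pi x P x y - pi y P y x through a state y vanishes by
   stationarity, so the flow across each edge does, by induction along the path. *)
Lemma stationary_reversible (R : realType) (n : nat) (P : 'M[R]_n.+1)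
    (pi : 'rV[R]_n.+1) :
  birth_and_death P -> pi *m P = pi -> reversible P pi.
Proof.
move=> [[P0 P1] Pfar] piP.
pose F x y := pi ord0 x * P x y - pi ord0 y * P y x.
have Fsum y : \sum_x F x y = 0.
  rewrite sumrB -mulr_sumr P1 mulr1; apply/eqP; rewrite subr_eq0; apply/eqP.
  by rewrite -[in RHS]piP mxE.
have FN x y : F x y = - F y x by rewrite /F opprB.
have Ffar (x y : 'I_n.+1) : (1 < `|Posz x - Posz y|)%N -> F x y = 0.
  by move=> xy; rewrite /F !Pfar ?mulr0 ?subrr// distnC.
have Fup k : forall x y : 'I_n.+1, y = k :> nat -> x = k.+1 :> nat -> F x y = 0.
  elim: k => [|k IHk] x y yk xk; rewrite -(Fsum y) (bigD1 x)//= big1 ?addr0// => z;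
    rewrite -val_eqE /= => zx.
  - have [->|zy] := eqVneq z y; first by rewrite /F subrr.
    by apply: Ffar; move: zy; rewrite -val_eqE /=; lia.
  - have [->|zy] := eqVneq z y; first by rewrite /F subrr.
    have [zk|zk] := eqVneq (z : nat) k; first by rewrite FN IHk ?oppr0.
    by apply: Ffar; move: zy; rewrite -val_eqE /=; lia.
suff F0 x y : F x y = 0 by move=> x y; apply/eqP; rewrite -subr_eq0; apply/eqP/F0.
have [xy|d] := ltnP 1 `|Posz x - Posz y|%N; first exact: Ffar.
have [->|xy] := eqVneq x y; first by rewrite /F subrr.
move: xy; rewrite -val_eqE /= => xy.
have [xy'|xy'] := ltnP x y; first by rewrite FN (Fup x) ?oppr0//; lia.
by rewrite (Fup y)//; lia.
Qed.

(** If pi vanished at y, detailed balance for a power with P^k x y > 0 would make it vanish at every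
    x, against total mass 1. *)
Lemma reversible_pos (R : realType) (n : nat) (P : 'M[R]_n.+1) (pi : 'rV[R]_n.+1) :
  irreducible P -> Defs.distribution pi -> reversible P pi -> forall y, 0 < pi ord0 y.
Proof.
move=> iP [pi0 pi1] rP y; rewrite lt0r pi0 andbT; apply/eqP => piy.
have : \sum_x pi ord0 x = 0.
  apply: big1 => x _; have [k Pk] := iP x y.
  have /eqP := reversible_expr _ _ _ _ k rP x y.
  by rewrite piy mul0r mulf_eq0 (gt_eqF Pk) orbF => /eqP.
by rewrite pi1 => /eqP; rewrite oner_eq0.
Qed.

(** * The corner minimum in discrete time *)

Definition min_at_corners {R : numFieldType} {n : nat} (K : 'M[R]_n.+1)
    (pi : 'rV[R]_n.+1) : Prop :=
  (forall x y, K ord0 ord_max / pi ord0 ord_max <= K x y / pi ord0 y) /\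
  K ord0 ord_max / pi ord0 ord_max = K ord_max ord0 / pi ord0 ord0.

Lemma lazy_min_at_corners (R : realType) (n : nat) (P : 'M[R]_n.+1)
    (pi : 'rV[R]_n.+1) (t : nat) :
  birth_and_death P -> lazy P -> reversible P pi -> (forall y, 0 < pi ord0 y) ->
  min_at_corners (P ^+ t) pi.
Proof.
move=> bP lP rP pi0.
have sym x y : (P ^+ t) x y / pi ord0 y = (P ^+ t) y x / pi ord0 x.
  apply/eqP; rewrite eqr_div ?(gt_eqF (pi0 _))//; apply/eqP.
  by rewrite mulrC (reversible_expr _ _ _ _ t rP) mulrC.
have last_col x : (P ^+ t) ord0 ord_max <= (P ^+ t) x ord_max.
  rewrite -2!(@extend_ord _ _ (fun x => (P ^+ t) x ord_max)) /=.
  elim: (x : nat) => // k IHk; apply: le_trans IHk _.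
  exact: nondecreasing_last_column.
have first_col x : (P ^+ t) ord_max ord0 <= (P ^+ t) x ord0.
  rewrite -2!(@extend_ord _ _ (fun x => (P ^+ t) x ord0)) /=.
  have dec k d : extend (fun x => (P ^+ t) x ord0) (k + d)
                 <= extend (fun x => (P ^+ t) x ord0) k.
    elim: d => [|d IHd]; first by rewrite addn0.
    by rewrite addnS; apply: le_trans IHd; apply: nonincreasing_first_column.
  by have := dec x (n - x)%N; rewrite subnKC// -ltnS.
split=> [x y|]; last exact: sym.
have xn : (x <= n)%N by rewrite -ltnS.
(* Column y is smallest at 0 or at n. Symmetry turns the entries (0, y) and (n, y) into (y, 0) and
   (y, n), which lie in the monotone columns; in the first case the corner (0, n) is turned into (n,
   0) as well. *)
have [] := unimodal_ge_ends _ _ n x (unimodal_column _ _ _ t y bP lP) xn.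
- rewrite -[0%N]/(val (@ord0 n)) !extend_ord => le.
  apply: (@le_trans _ _ ((P ^+ t) ord0 y / pi ord0 y)); last by rewrite ler_pM2r ?invr_gt0.
  by rewrite (sym ord0 y) (sym ord0 ord_max) ler_pM2r ?invr_gt0.
- rewrite -[X in extend _ X <= _]/(val (@ord_max n)) !extend_ord => le.
  apply: (@le_trans _ _ ((P ^+ t) ord_max y / pi ord0 y)); last by rewrite ler_pM2r ?invr_gt0.
  by rewrite (sym _ y) ler_pM2r ?invr_gt0.
Qed.

(** * The exponential as a limit of powers *)

Local Open Scope classical_set_scope.

Lemma cvg_mx_entries (R : realFieldType) (m n : nat) (T : Type) (F : set_system T)
    (FF : Filter F) (u : T -> 'M[R]_(m, n)) (L : 'M[R]_(m, n)) :
  (forall i j, u x i j @[x --> F] --> L i j) -> u x @[x --> F] --> L.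
Proof.
move=> uL; apply/cvgrPdist_le => /= e e0; near=> x.
rewrite /Num.Def.normr/= mx_normrE (bigmax_le _ (ltW e0))//= => i _.
rewrite !mxE; move: i; near: x; apply: filter_forall => /= i.
exact: (cvgrPdist_le _ _).1 (uL i.1 i.2) _ e0.
Unshelve. all: by end_near. Qed.

Lemma ffact_le_expn (n k : nat) : (n ^_ k <= n ^ k)%N.
Proof.
rewrite ffact_prod -[X in (_ <= _ ^ X)%N](card_ord k) -prod_nat_const.
by apply: leq_prod => i _; apply: leq_subr.
Qed.

Lemma bernoulli_ineq (R : realDomainType) (v : R) (k : nat) :
  0 <= v <= 1 -> 1 - v *+ k <= (1 - v) ^+ k.
Proof.
move=> /andP[v0 v1]; elim: k => [|k IHk]; first by rewrite mulr0n subr0 expr0.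
apply: (@le_trans _ _ ((1 - v) * (1 - v *+ k))).
  rewrite mulrSr; have : 0 <= v * (v *+ k) by rewrite mulr_ge0// mulrn_wge0.
  lra.
by rewrite exprS ler_wpM2l// subr_ge0.
Qed.

(** A squeeze: for u = a / N in [0, 1], 1 - u <= exp(-u) gives exp(u) (1 - u^2) <= 1 + u <= exp(u).
    In the N-th power, Bernoulli bounds (1 - u^2)^N below by 1 - a^2 / N. *)
Lemma euler_cvg_expR (R : realType) (a : R) :
  0 <= a -> (1 + k.+1%:R^-1 * a) ^+ k.+1 @[k --> \oo] --> expR a.
Proof.
move=> a0.
apply: (@squeeze_cvgr _ _ _ _ (fun k => expR a * (1 - a ^+ 2 * k.+1%:R^-1)) (fun=> expR a)); last 2 first.
- rewrite -[X in _ --> X]mulr1; apply: cvgMr.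
  rewrite -[X in _ --> X]subr0; apply: cvgB; first exact: cvg_cst.
  rewrite -[X in _ --> X](mulr0 (a ^+ 2)); apply: cvgMr; exact: cvg_harmonic.
- exact: cvg_cst.
near=> k.
have k0 : 0 < k.+1%:R :> R by rewrite ltr0n.
have ak : a <= k.+1%:R.
  by near: k; apply: filterS (nbhs_infty_ger a) => k /le_trans; apply; rewrite ler_nat.
set u := k.+1%:R^-1 * a.
have u0 : 0 <= u by rewrite mulr_ge0// invr_ge0 ltW.
have u1 : u <= 1 by rewrite /u mulrC ler_pdivrMr// mul1r.
have eu : expR u ^+ k.+1 = expR a by rewrite -expRM_natl /u mulVKf// gt_eqF.
apply/andP; split; last first.
  by rewrite -eu lerXn2r ?nnegrE ?expR_ge0 ?addr_ge0// expR_ge1Dx.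
have uu : u ^+ 2 <= 1 by rewrite expr_le1.
have step : expR u * (1 - u ^+ 2) <= 1 + u.
  rewrite -ler_pdivlMl ?expR_gt0// -expRN mulrC.
  apply: le_trans (ler_wpM2l (addr_ge0 ler01 u0) (expR_ge1Dx (- u))); lra.
apply: (@le_trans _ _ ((expR u * (1 - u ^+ 2)) ^+ k.+1)); last first.
  by rewrite lerXn2r// ?nnegrE ?mulr_ge0 ?expR_ge0 ?subr_ge0 ?addr_ge0.
rewrite exprMn eu ler_wpM2l ?expR_ge0//.
apply: le_trans (bernoulli_ineq _ _ _ _); last by rewrite sqr_ge0.
have -> : u ^+ 2 *+ k.+1 = a ^+ 2 * k.+1%:R^-1; last exact: lexx.
by rewrite /u -mulr_natr; field; rewrite addrC natr1 gt_eqF.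
Unshelve. all: by end_near. Qed.

Lemma expr_mx_entry_le (R : numDomainType) (n : nat) (A : 'M[R]_n.+1) (a : R) :
  (forall i, \sum_j `|A i j| <= a) -> forall k i j, `|(A ^+ k) i j| <= a ^+ k.
Proof.
move=> Aa; have a0 : 0 <= a by apply: le_trans (Aa ord0); rewrite sumr_ge0.
elim=> [|k IHk] i j; first by rewrite !expr0 mxE; case: eqP; rewrite ?normr1 ?normr0 ?ler01.
rewrite exprS -[_ * _]/(_ *m _) mxE (le_trans (ler_norm_sum _ _ _))//.
apply: (@le_trans _ _ (\sum_l `|A i l| * a ^+ k)).
  by apply: ler_sum => l _; rewrite normrM ler_wpM2l.
by rewrite -mulr_suml exprS ler_wpM2r ?exprn_ge0.
Qed.

(** This geometric bound lets the scalar exponential series at a dominate the matrix series entry by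
    entry. The sum of all absolute entries dominates each row sum. *)
Lemma mx_entry_bound (R : numDomainType) (n : nat) (A : 'M[R]_n.+1) :
  exists2 a, 0 <= a & forall k i j, `|(A ^+ k) i j| <= a ^+ k.
Proof.
exists (\sum_i \sum_j `|A i j|); first by rewrite sumr_ge0// => i _; rewrite sumr_ge0.
apply: expr_mx_entry_le => i; rewrite [leRHS](bigD1 i)//= lerDl.
by rewrite sumr_ge0// => ? _; rewrite sumr_ge0.
Qed.

Lemma series_expmx_entry (R : realType) (n : nat) (A : 'M[R]_n.+1) i j N :
  series (fun k => k`!%:R^-1 *: A ^+ k) N i j =
  series (fun k => k`!%:R^-1 * (A ^+ k) i j) N.
Proof. by rewrite /series /= summxE; apply: eq_bigr => k _; rewrite mxE. Qed.

(** Since [limn] is total, convergence must be established first: each entry converges absolutely by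
    comparison with [exp_coeff a], hence so does the matrix series, and coordinates are
    continuous. *)
Lemma expmx_entry_cvg (R : realType) (n : nat) (A : 'M[R]_n.+1) i j :
  series (fun k => k`!%:R^-1 * (A ^+ k) i j) N @[N --> \oo] --> expmx A i j.
Proof.
have [a a0 Aa] := mx_entry_bound _ _ A.
have entry_cvg i' j' : cvgn (series (fun k => k`!%:R^-1 * (A ^+ k) i' j')).
  apply: (@normed_cvg _ R^o); apply: (@series_le_cvg _ _ (exp_coeff a)) => [k|k|k|].
  - exact: normr_ge0.
  - exact: exp_coeff_ge0.
  - by rewrite /= normrM ger0_norm ?invr_ge0// /exp_coeff /= mulrC ler_wpM2r ?invr_ge0.
  - exact: is_cvg_series_exp_coeff.
have mx_cvg : cvgn (series (fun k => k`!%:R^-1 *: A ^+ k)).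
  apply/cvg_ex; exists (\matrix_(i', j') limn (series (fun k => k`!%:R^-1 * (A ^+ k) i' j'))).
  apply: cvg_mx_entries => i' j'; rewrite mxE.
  under eq_fun do rewrite series_expmx_entry.
  exact: entry_cvg.
under eq_fun do rewrite -series_expmx_entry.
exact: (continuous_cvg _ (@coord_continuous _ _ _ i j _) mx_cvg).
Qed.

(* Both sides are expanded in powers of A, where 'C(N, k) / N ^ k <= 1 / k!. *)
Lemma euler_mx_error (R : realType) (n : nat) (A : 'M[R]_n.+1) (a : R) (N : nat) i j :
  (forall k, `|(A ^+ k) i j| <= a ^+ k) -> (0 < N)%N ->
  `|series (fun k => k`!%:R^-1 * (A ^+ k) i j) N.+1 - ((1 + N%:R^-1 *: A) ^+ N) i j|
  <= series (exp_coeff a) N.+1 - (1 + N%:R^-1 * a) ^+ N.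
Proof.
move=> Aa N0.
have -> : ((1 + N%:R^-1 *: A) ^+ N) i j =
    \sum_(k < N.+1) (N%:R^-1 ^+ k *+ 'C(N, k)) * (A ^+ k) i j.
  rewrite addrC exprD1n summxE; apply: eq_bigr => k _.
  by rewrite exprZn -scaler_nat !mxE mulrA mulr_natl.
rewrite [1 + _ * a]addrC exprD1n /series /= !big_mkord -!sumrB.
apply: (le_trans (ler_norm_sum _ _ _)); apply: ler_sum => k _.
(* As these coefficients are nonnegative, the triangle inequality bounds the matrix error by exactly
   the scalar error at a. *)
have c0 : 0 <= k`!%:R^-1 - N%:R^-1 ^+ k *+ 'C(N, k) :> R.
  rewrite subr_ge0 -mulr_natl exprVn ler_pdivrMr ?exprn_gt0 ?ltr0n//.
  rewrite ler_pdivlMl ?ltr0n ?fact_gt0// -natrX -natrM ler_nat mulnC bin_ffact.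
  exact: ffact_le_expn.
rewrite -mulrBl normrM ger0_norm// exprMn /exp_coeff /= [a ^+ k / _]mulrC -mulrnAl -mulrBl.
exact: ler_wpM2l.
Qed.

Lemma euler_cvg_expmx (R : realType) (n : nat) (A : 'M[R]_n.+1) i j :
  ((1 + N.+1%:R^-1 *: A) ^+ N.+1) i j @[N --> \oo] --> expmx A i j.
Proof.
have [a a0 Aa] := mx_entry_bound _ _ A.
(* The exponent N.+1 brings in the powers 0 to N.+1 of A, hence N.+2 terms of the series. *)
pose S N := series (fun k => k`!%:R^-1 * (A ^+ k) i j) N.+2.
pose D N := S N - ((1 + N.+1%:R^-1 *: A) ^+ N.+1) i j.
pose E N := series (exp_coeff a) N.+2 - (1 + N.+1%:R^-1 * a) ^+ N.+1.
have Scvg : S N @[N --> \oo] --> expmx A i j.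
  by have := expmx_entry_cvg _ _ A i j; rewrite -2!cvg_shiftS.
have E0 : E N @[N --> \oo] --> 0.
  rewrite -[X in _ --> X](subrr (expR a)); apply: cvgB; last exact: euler_cvg_expR.
  have : series (exp_coeff a) N @[N --> \oo] --> expR a by exact: is_cvg_series_exp_coeff.
  by rewrite -2!cvg_shiftS.
have D0 : D N @[N --> \oo] --> 0.
  apply: norm_cvg0; apply: (squeeze_cvgr _ (cvg_cst 0) E0).
  by near=> N; rewrite normr_ge0/=; apply: euler_mx_error.
have -> : (fun N => ((1 + N.+1%:R^-1 *: A) ^+ N.+1) i j) = (fun N => S N - D N).
  by apply/funext => N; rewrite /D subKr.
by rewrite -[X in _ --> X]subr0; apply: cvgB.
Unshelve. all: by end_near. Qed.

(** Past the terms of order 0 and 1, the matrix series is dominated term by term by the scalar one.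
    Applied to t A, the bound is of order t^2, which replaces a derivative at t = 0. *)
Lemma expmx_linear_error (R : realType) (n : nat) (A : 'M[R]_n.+1) (a : R) i j :
  (forall k, `|(A ^+ k) i j| <= a ^+ k) ->
  `|(expmx A - 1 - A) i j| <= expR a - 1 - a.
Proof.
move=> Aa.
have S_cvg := expmx_entry_cvg _ _ A i j.
have e_cvg : series (exp_coeff a) N @[N --> \oo] --> expR a by exact: is_cvg_series_exp_coeff.
have l_cvg : `|series (fun k => k`!%:R^-1 * (A ^+ k) i j) N - (1 + A) i j| @[N --> \oo]
    --> `|(expmx A - 1 - A) i j|.
  apply: cvg_norm.
  have -> : (expmx A - 1 - A) i j = expmx A i j - (1 + A) i j by rewrite !mxE; ring.
  by apply: cvgB => //; exact: cvg_cst.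
have r_cvg : series (exp_coeff a) N - (1 + a) @[N --> \oo] --> expR a - 1 - a.
  by rewrite -addrA -opprD; apply: cvgB => //; exact: cvg_cst.
apply: (ler_cvg_to l_cvg r_cvg); near=> N.
have -> : N = (N - 2).+2 by rewrite -addn2 subnK//; near: N; exists 2%N.
rewrite /series /= !(big_nat_recl _ 0)//= /exp_coeff /=.
rewrite !expr0 !expr1 fact0 factS fact0 !invr1 !mul1r mulr1 !mxE.
have cancel (x y z : R) : x + (y + z) - (x + y) = z by ring.
rewrite !cancel; apply: le_trans (ler_norm_sum _ _ _) _; apply: ler_sum => k _.
by rewrite normrM ger0_norm ?invr_ge0// mulrC ler_wpM2r ?invr_ge0.
Unshelve. all: by end_near. Qed.

(** * Continuous time *)

(** One has exp(u) (1 - u) <= 1, while (1 + u + 2 u^2) (1 - u) = 1 + u^2 (1 - 2 u) >= 1. *)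
Lemma expR_quadratic_bound (R : realType) (u : R) :
  0 <= u <= 2^-1 -> expR u - 1 - u <= 2 * u ^+ 2.
Proof.
move=> /andP[u0 u2].
have : expR u * (1 - u) <= (1 + u + 2 * u ^+ 2) * (1 - u).
  apply: (@le_trans _ _ 1).
    rewrite -ler_pdivlMl ?expR_gt0// -expRN mulr1; exact: expR_ge1Dx.
  have : 0 <= u ^+ 2 * (1 - 2 * u) by rewrite mulr_ge0 ?sqr_ge0//; lra.
  lra.
by rewrite ler_pM2r; lra.
Qed.

(** With A = P - 1, invariance gives pi (H_t - 1 - t A) = - t pi A. The left side is of order t^2,
    so a nonzero entry of pi A is contradicted at small t. *)
Lemma semigroup_generator_stationary (R : realType) (n : nat) (P : 'M[R]_n.+1)
    (pi : 'rV[R]_n.+1) :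
  stationary_semigroup (heat_kernel P) pi -> pi *m P = pi.
Proof.
move=> [[pi0 pi1] piH]; set A := P - 1.
suff : pi *m A = 0 by rewrite /A mulmxBr mulmx1 => /eqP; rewrite subr_eq0 => /eqP.
apply/matrixP => i j; rewrite ord1 [RHS]mxE; apply/eqP; apply: contraT => vn0.
set c := `|(pi *m A) ord0 j|; have c0 : 0 < c by rewrite normr_gt0.
have [a a0 Aa] := mx_entry_bound _ _ A.
have small t : 0 <= t -> t * c <= expR (t * a) - 1 - t * a.
  move=> t0; have -> : t * c = `|(pi *m (heat_kernel P t - 1 - t *: A)) ord0 j|.
    rewrite !mulmxBr piH// mulmx1 subrr sub0r mxE normrN -scalemxAr mxE.
    by rewrite normrM ger0_norm.
  rewrite mxE; apply: le_trans (ler_norm_sum _ _ _) _.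
  rewrite -[leRHS]mul1r -[X in X * _]pi1 mulr_suml; apply: ler_sum => l _.
  rewrite normrM ger0_norm// ler_wpM2l//; apply: (@expmx_linear_error _ _ (t *: A) (t * a)) => k.
  rewrite exprZn mxE normrM normrX (ger0_norm t0) exprMn ler_wpM2l// exprn_ge0//.
(* For t = c / D, the summand 2 a c ensures t a <= 1/2, and 2 a^2 makes 2 t a^2 smaller than t D =
   c. The last c makes D positive and the comparison strict. *)
pose D := 2 * a * c + 2 * a ^+ 2 + c.
have D0 : 0 < D.
  by rewrite /D ltr_wpDl// addr_ge0// ?mulr_ge0// ?sqr_ge0// ltW.
pose t := c / D; have t0 : 0 < t by rewrite divr_gt0.
have tD : t * D = c by rewrite /t divfK// gt_eqF.
have ta : 0 <= t * a <= 2^-1.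
  rewrite mulr_ge0 ?(ltW t0)//=.
  rewrite /t mulrAC ler_pdivrMr// /D.
  by have := sqr_ge0 a; nra.
clearbody t; have := le_trans (small t (ltW t0)) (expR_quadratic_bound _ _ ta).
rewrite exprMn expr2 -!mulrA [2 * _]mulrCA ler_pM2l// => H.
have : t * (2 * a * c + c) <= 0.
  have : c = t * (2 * a * c + c) + 2 * (t * a ^+ 2) by rewrite -[LHS]tD /D; ring.
  lra.
rewrite pmulr_rle0// leNgt => /negP; case.
by rewrite ltr_wpDl// !mulr_ge0// ltW.
Qed.

(** The matrix is the convex combination (1 - s) I + s P, whose holding probabilities are at least 1
    - s >= 1/2. *)
Lemma lazified_chain (R : realType) (n : nat) (P : 'M[R]_n.+1) (s : R) :
  0 <= s <= 2^-1 -> birth_and_death P ->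
  birth_and_death (1 + s *: (P - 1)) /\ lazy (1 + s *: (P - 1)).
Proof.
move=> /andP[s0 s1] [[P0 P1] Pfar].
have Qe x y : (1 + s *: (P - 1)) x y = (1 - s) * (x == y)%:R + s * P x y.
  by rewrite !mxE; ring.
split; [split; [split|]|] => [x y|x|x y xy|x]; rewrite ?Qe.
- by rewrite addr_ge0// mulr_ge0//; lra.
- under eq_bigr do rewrite Qe.
  rewrite big_split -!mulr_sumr P1/= (bigD1 x)//= eqxx big1 ?addr0; first by rewrite !mulr1 subrK.
  by move=> y /negbTE; rewrite eq_sym => ->.
- have /negbTE-> : x != y by apply: contraTneq xy => ->; rewrite subrr.
  by rewrite Pfar// !mulr0 addr0.
- by rewrite eqxx mulr1; have : 0 <= s * P x x by [exact: mulr_ge0]; lra.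
Qed.

Lemma lazified_reversible (R : realType) (n : nat) (P : 'M[R]_n.+1)
    (pi : 'rV[R]_n.+1) (s : R) :
  reversible P pi -> reversible (1 + s *: (P - 1)) pi.
Proof.
move=> rP x y; rewrite !mxE eq_sym; have := rP x y.
by case: eqP => [->//|_] rPxy; rewrite mulr0n !add0r !subr0 mulrCA rPxy mulrCA.
Qed.

Lemma heat_kernel_min_at_corners (R : realType) (n : nat) (P : 'M[R]_n.+1)
    (pi : 'rV[R]_n.+1) (t : R) :
  birth_and_death P -> reversible P pi -> (forall y, 0 < pi ord0 y) -> 0 <= t ->
  min_at_corners (heat_kernel P t) pi.
Proof.
move=> bP rP pi0 t0.
pose Q N : 'M[R]_n.+1 := (1 + N.+1%:R^-1 *: (t *: (P - 1))) ^+ N.+1.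
have Qcvg x y : Q N x y / pi ord0 y @[N --> \oo] --> heat_kernel P t x y / pi ord0 y.
  by apply: cvgMl; apply: euler_cvg_expmx.
have Qmin : \forall N \near \oo, min_at_corners (Q N) pi.
  near=> N.
  (* The base of the power is the lazified kernel with s = t / N.+1, so N.+1 >= 2 t is required. *)
  have s01 : 0 <= N.+1%:R^-1 * t <= 2^-1.
    rewrite mulr_ge0 ?invr_ge0//= mulrC ler_pdivrMr ?ltr0n//.
    suff : 2 * t <= N.+1%:R by lra.
    by near: N; apply: filterS (nbhs_infty_ger (2 * t)) => k /le_trans; apply; rewrite ler_nat.
  have [bQ lQ] := lazified_chain _ _ _ _ s01 bP.
  rewrite /Q scalerA; apply: lazy_min_at_corners => //.
  exact: lazified_reversible.
(* Large inequalities pass to the limit; the equality of the two corners passes as a pair of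
   them. *)
split=> [x y|].
  by apply: (ler_cvg_to (Qcvg _ _) (Qcvg _ _)); near=> N; apply: (near Qmin N _).1.
apply/eqP; rewrite eq_le; apply/andP; split;
  by apply: (ler_cvg_to (Qcvg _ _) (Qcvg _ _)); near=> N; rewrite (near Qmin N _).2.
Unshelve. all: by end_near. Qed.

Lemma separation_max_at_corners (R : realType) (n : nat) (K : 'M[R]_n.+1)
    (pi : 'rV[R]_n.+1) :
  min_at_corners K pi ->
  is_max_value (separation K pi) (1 - K ord0 ord_max / pi ord0 ord_max) /\
  1 - K ord0 ord_max / pi ord0 ord_max = 1 - K ord_max ord0 / pi ord0 ord0.
Proof.
move=> [Kmin Kcorner]; split; last by rewrite Kcorner.
split; first by exists ord0, ord_max.
by move=> x y; rewrite /separation lerD2l lerN2.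
Qed.

Local Close Scope classical_set_scope.

Theorem proposition4 (R : realType) (n : nat) :
  (forall (P : 'M[R]_n.+1) (pi : 'rV[R]_n.+1),
     birth_and_death P -> lazy P -> irreducible P -> stationary P pi ->
     forall t : nat, (0 < t)%N ->
       is_max_value (separation (P ^+ t) pi)
         (1 - (P ^+ t) ord0 ord_max / pi ord0 ord_max) /\
       1 - (P ^+ t) ord0 ord_max / pi ord0 ord_max =
         1 - (P ^+ t) ord_max ord0 / pi ord0 ord0)
  /\
  (forall (P : 'M[R]_n.+1) (pi : 'rV[R]_n.+1),
     birth_and_death P -> irreducible P ->
     stationary_semigroup (heat_kernel P) pi ->
     forall t : R, 0 < t ->
       is_max_value (separation (heat_kernel P t) pi)
         (1 - heat_kernel P t ord0 ord_max / pi ord0 ord_max) /\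
       1 - heat_kernel P t ord0 ord_max / pi ord0 ord_max =
         1 - heat_kernel P t ord_max ord0 / pi ord0 ord0).
Proof.
split=> [P pi bP lP iP [dpi piP] t _|P pi bP iP spi t t0];
    apply: separation_max_at_corners.
- have rP := stationary_reversible _ _ _ _ bP piP.
  by apply: lazy_min_at_corners => //; apply: reversible_pos rP.
(* Invariance under the semigroup is reduced to pi P = pi, so that detailed balance follows as in
   discrete time. *)
- have rP := stationary_reversible _ _ _ _ bP (semigroup_generator_stationary _ _ _ _ spi).
  apply: heat_kernel_min_at_corners (ltW t0) => //.
  by apply: reversible_pos rP => //; case: spi.
Qed.
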